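(* Let $M$ and $\widehat M$ be surfaces. Let $q\colon[0,\tau]\to Q$ be a rolling of $M$ on $\widehat M$ such that $x(t)=\pi q(t)$ and $\widehat x(t)=\widehat\pi q(t)$ are $C^2$ curves parametrized by arc-length. Then $q(t)$ is a continuous loop in $Q$ (i.e. $q(0)=q(\tau)$) if and only if both $x(t)$ and $\widehat x(t)$ are continuous loops (i.e. $x(0)=x(\tau)$ and $\widehat x(0)=\widehat x(\tau)$) for which the oriented angles $\angle(\dot x(0),\dot x(\tau))$ and $\angle(\dot{\widehat x}(0),\dot{\widehat x}(\tau))$ coincide.
   Context: A surface is a 2-dimensional, connected, oriented Riemannian manifold. For unit vectors $u,w$ in an oriented 2-dimensional inner product space, $\angle(u,w)\in\mathbb R/2\pi\mathbb Z$ is the angle of the positively oriented rotation taking $u$ to $w$. Rolling. Let $M,\widehat M$ be connected, oriented Riemannian manifolds of the same dimension $n$. Let $Q=\{q\in \mathrm{SO}(T_xM,T_{\widehat x}\widehat M): x\in M,\ \widehat x\in\widehat M\}$, where $\mathrm{SO}(V,W)$ is the set of orientation preserving linear isometries between oriented inner product spaces $V$ and $W$; $Q$ is a smooth fiber bundle over $M\times\widehat M$, with projections $\pi\colon Q\to M$, $\widehat\pi\colon Q\to\widehat M$. A rolling (without slipping or twisting) of $M$ on $\widehat M$ is an absolutely continuous curve $q\colon[0,\tau]\to Q$ such that, with $x(t)=\pi q(t)$ and $\widehat x(t)=\widehat\pi q(t)$: (I) no slip: $\dot{\widehat x}(t)=q(t)\dot x(t)$ for almost all $t$; (II) no twist: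 $q(t)\frac{D}{dt}Z(t)=\frac{D}{dt}\big(q(t)Z(t)\big)$ for almost every $t$, for every (absolutely continuous) vector field $Z(t)$ along $x(t)$. Here $\frac{D}{dt}$ is the covariant derivative along the curve for the Levi-Civita connection of the respective manifold. *)

(* Defs.v *)
(* Vectors are row vectors: a linear map of matrix A sends v to v *m A, and
   matrix products compose maps from left to right. *)
From mathcomp Require Import all_boot all_order all_algebra.
From mathcomp Require Import all_classical all_reals all_analysis.
From mathcomp Require Import lra.

Set Implicit Arguments.
Unset Strict Implicit.
Unset Printing Implicit Defensive.

Import Order.TTheory GRing.Theory Num.Theory.
Import numFieldNormedType.Exports.

Local Open Scope classical_set_scope.
Local Open Scope ring_scope.

(* For an open set U, this is the class C^k: a C^1 map is a differentiable map
   whose directional derivatives are all continuous. *)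
Fixpoint Ck_on (R : realType) (V W : normedModType R) (k : nat)
    (U : set V) (f : V -> W) : Prop :=
  if k is k'.+1 then
    (forall x, U x -> differentiable f x) /\
    (forall v : V, Ck_on k' U (fun x => 'D_v f x))
  else forall x, U x -> {for x, continuous f}.

Definition smooth_on (R : realType) (V W : normedModType R)
    (U : set V) (f : V -> W) : Prop :=
  forall k, Ck_on k U f.

(* A connected, oriented, n-dimensional Riemannian manifold, given by an
   oriented smooth atlas (phi i, of domain dom i and inverse psi i) and the
   Gram matrices of the metric in its charts.  The only role of chart_at is to
   select, for each p, a chart around p in whose coordinates the elements of
   T_p are written (see tangent). *)
Record riemannian (R : realType) (n : nat) := Riemannian {
  carrier :> topologicalType ;
  mfd_hausdorff : hausdorff_space carrier ;
  mfd_second_countable : @second_countable carrier ;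
  mfd_connected : connected [set: carrier] ;
  index : Type ;
  dom : index -> set carrier ;
  phi : index -> carrier -> 'rV[R]_n ;
  psi : index -> 'rV[R]_n -> carrier ;
  dom_open : forall i, open (dom i) ;
  img_open : forall i, open (phi i @` dom i) ;
  phiK : forall i p, dom i p -> psi i (phi i p) = p ;
  phi_continuous : forall i, {within dom i, continuous (phi i)} ;
  psi_continuous : forall i, {within phi i @` dom i, continuous (psi i)} ;
  chart_at : carrier -> index ;
  dom_chart_at : forall p, dom (chart_at p) p ;
  transition_smooth : forall i j,
    smooth_on (phi i @` (dom i `&` dom j)) (phi j \o psi i) ;
  transition_oriented : forall i j p, dom i p -> dom j p ->
    0 < \det (jacobian (phi j \o psi i) (phi i p)) ;
  gram : index -> 'rV[R]_n -> 'M[R]_n ;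
  gram_smooth : forall i, smooth_on (phi i @` dom i) (gram i) ;
  gram_sym : forall i p, dom i p -> (gram i (phi i p))^T = gram i (phi i p) ;
  gram_posdef : forall i p (v : 'rV[R]_n), dom i p -> v != 0 ->
    0 < (v *m gram i (phi i p) *m v^T) 0 0 ;
  gram_transition : forall i j p, dom i p -> dom j p ->
    gram i (phi i p) =
      jacobian (phi j \o psi i) (phi i p) *m gram j (phi j p)
        *m (jacobian (phi j \o psi i) (phi i p))^T }.

Definition surface (R : realType) := riemannian R 2.

Section Geometry.
Context {R : realType} {n : nat}.
Implicit Type M : riemannian R n.

(* T_p M, each vector being identified with its coordinates in the chart
   chart_at p. *)
Definition tangent M (p : M) : Type := 'rV[R]_n.

(* Change of coordinates, from the chart i to the chart j, for tangent vectors
   at p. *)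
Definition dtrans M (i j : index M) (p : M) : 'M[R]_n :=
  jacobian (phi j \o psi i) (phi i p).

(* Coordinates in the chart i of a tangent vector at p. *)
Definition coord M (i : index M) (p : M) (v : tangent p) : 'rV[R]_n :=
  (v : 'rV[R]_n) *m dtrans (chart_at p) i p.

Definition metric M (p : M) : 'M[R]_n :=
  gram (chart_at p) (phi (chart_at p) p).

Definition inner M (p : M) (u v : tangent p) : R :=
  ((u : 'rV[R]_n) *m metric p *m (v : 'rV[R]_n)^T) 0 0.

(* Christoffel symbol Gamma^k_{ab} of the Levi-Civita connection at the point
   of coordinates y in the chart i. *)
Definition dgram M (i : index M) (y : 'rV[R]_n) (c a b : 'I_n) : R :=
  'D_(delta_mx 0 c) (fun z => gram i z a b) y.

Definition christoffel M (i : index M) (y : 'rV[R]_n) (k a b : 'I_n) : R :=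
  2^-1 * \sum_l (invmx (gram i y)) k l *
    (dgram i y a b l + dgram i y b a l - dgram i y l a b).

Definition connection_term M (i : index M) (y u v : 'rV[R]_n) : 'rV[R]_n :=
  \row_k \sum_a \sum_b christoffel i y k a b * u 0 a * v 0 b.

End Geometry.

Section LeviCivita.
Context {R : realType} {n : nat} (M : riemannian R n) (i : index M) (p : M).
Hypothesis p_i : dom i p.
Let y := phi i p.

Lemma gram_unit : gram i y \in unitmx.
Proof.
rewrite -row_free_unit -kermx_eq0; apply/negPn/negP => /rowV0Pn [v].
move=> /sub_kermxP vG v0; have := gram_posdef p_i v0.
by rewrite -/y vG mul0mx mxE ltxx.
Qed.

Lemma dgram_sym c a b : dgram i y c a b = dgram i y c b a.
Proof.
apply: near_eq_derive.
have : nbhs y (phi i @` dom i).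
  by apply: open_nbhs_nbhs; split; [exact: img_open | exists p].
apply: filterS => _ [p' p'_i <-] /=.
by rewrite -[in RHS](gram_sym p'_i) mxE.
Qed.

Lemma christoffel_torsion_free k a b :
  christoffel i y k a b = christoffel i y k b a.
Proof.
rewrite /christoffel; congr (_ * _); apply: eq_bigr => l _.
by rewrite (dgram_sym l a b) [dgram i y a b l + _]addrC.
Qed.

Lemma christoffel_lower c a b :
  \sum_k christoffel i y k c a * gram i y k b =
  2^-1 * (dgram i y c a b + dgram i y a c b - dgram i y b c a).
Proof.
pose D l := dgram i y c a l + dgram i y a c l - dgram i y l c a.
transitivity (2^-1 * \sum_l (gram i y *m invmx (gram i y)) b l * D l).
  under eq_bigr => k _ do
    rewrite /christoffel -mulrA [X in _ * X]mulr_suml mulr_sumr.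
  rewrite exchange_big mulr_sumr /=; apply: eq_bigr => l _.
  rewrite mxE mulr_suml mulr_sumr; apply: eq_bigr => k _.
  have -> : gram i y k b = gram i y b k by rewrite -[in LHS]gram_sym // mxE.
  by congr (_ * _); rewrite mulrC mulrA.
rewrite mulmxV ?gram_unit // (bigD1 b) //= big1 ?addr0 => [|l lb].
  by rewrite mxE eqxx mul1r.
by rewrite mxE eq_sym (negPf lb) mul0r.
Qed.

Lemma christoffel_metric c a b :
  dgram i y c a b = \sum_k christoffel i y k c a * gram i y k b +
                    \sum_k christoffel i y k c b * gram i y k a.
Proof.
by rewrite !christoffel_lower (dgram_sym c b a); lra.
Qed.

End LeviCivita.

Section Curves.
Context {R : realType}.

(* Derivative at t of f relatively to A; for A = [0, tau] it is the usual
   derivative for 0 < t < tau and a one-sided one at the ends. *)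
Definition has_deriv_on {V : normedModType R} (A : set R) (f : R -> V) (t : R)
    (l : V) : Prop :=
  (fun s => (s - t)^-1 *: (f s - f t)) @ within A t^' --> l.

Definition deriv_on {V : normedModType R} (A : set R) (f : R -> V) (t : R) : V :=
  lim ((fun s => (s - t)^-1 *: (f s - f t)) @ within A t^').

Definition abs_continuous_on {V : normedModType R} (a b : R) (f : R -> V) :
    Prop :=
  forall e : R, 0 < e -> exists2 d : R, 0 < d &
    forall (m : nat) (l r : 'I_m -> R),
      (forall k, [/\ a <= l k, l k <= r k & r k <= b]) ->
      (forall j k, j != k -> r j <= l k \/ r k <= l j) ->
      \sum_k (r k - l k) < d ->
      \sum_k `|f (r k) - f (l k)| < e.

Context {n : nat}.
Implicit Type M : riemannian R n.

(* Curves are functions on R of which only the restriction to [0, tau]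
   matters. *)

Definition in_chart M (x : R -> M) (i : index M) (a b : R) : Prop :=
  forall t, a <= t <= b -> dom i (x t).

Definition abs_continuous_curve M (tau : R) (x : R -> M) : Prop :=
  {within `[0, tau], continuous x} /\
  forall (i : index M) (a b : R), 0 <= a -> b <= tau -> in_chart x i a b ->
    abs_continuous_on a b (phi i \o x).

Definition C2_curve M (tau : R) (x : R -> M) : Prop :=
  {within `[0, tau], continuous x} /\
  forall i : index M, exists f1 f2 : R -> 'rV[R]_n,
    forall t, 0 <= t <= tau -> dom i (x t) ->
      [/\ has_deriv_on `[0, tau] (phi i \o x) t (f1 t),
          has_deriv_on `[0, tau] f1 t (f2 t) &
          f2 @ within `[0, tau] (nbhs t) --> f2 t].

Definition has_velocity M (tau : R) (x : R -> M) (t : R) (v : tangent (x t)) :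
    Prop :=
  has_deriv_on `[0, tau] (phi (chart_at (x t)) \o x) t (v : 'rV[R]_n).

Definition velocity M (tau : R) (x : R -> M) (t : R) : tangent (x t) :=
  deriv_on `[0, tau] (phi (chart_at (x t)) \o x) t.

Definition arclength M (tau : R) (x : R -> M) : Prop :=
  forall t, 0 <= t <= tau -> inner (velocity tau x t) (velocity tau x t) = 1.

Definition abs_continuous_field M (tau : R) (x : R -> M)
    (Z : forall t, tangent (x t)) : Prop :=
  forall (i : index M) (a b : R), 0 <= a -> b <= tau -> in_chart x i a b ->
    abs_continuous_on a b (fun t => coord i (Z t)).

(* DZ/dt exists at t and equals W: in the chart c = chart_at (x t) its
   coordinates are dZ^k/dt + Gamma^k_{ab} x'^a Z^b. *)
Definition has_covariant_deriv M (tau : R) (x : R -> M)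
    (Z : forall t, tangent (x t)) (t : R) (W : tangent (x t)) : Prop :=
  let c := chart_at (x t) in
  exists (v : tangent (x t)) (dZ : 'rV[R]_n),
    [/\ has_velocity tau v,
        has_deriv_on `[0, tau] (fun s => coord c (Z s)) t dZ &
        (W : 'rV[R]_n) = dZ + connection_term c (phi c (x t)) v (Z t)].

End Curves.

Section Rolling.
Context {R : realType} {n : nat}.
Implicit Types M N : riemannian R n.

(* A is (the matrix of) an element of SO(T_p M, T_p' N). Since the atlases are
   oriented, it preserves the orientation iff its matrix in charts of these
   atlases has a positive determinant. *)
Definition is_SO M N (p : M) (p' : N) (A : 'M[R]_n) : Prop :=
  (forall u v : tangent p,
     inner (p := p') ((u : 'rV[R]_n) *m A) ((v : 'rV[R]_n) *m A) = inner u v) /\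
  0 < \det A.

(* The space Q. *)
Record config M N := Config {
  src : M ;
  tgt : N ;
  lin : 'M[R]_n ;
  lin_SO : is_SO src tgt lin }.

Definition act M N (q : config M N) (v : tangent (src q)) : tangent (tgt q) :=
  (v : 'rV[R]_n) *m lin q.

(* Matrix of q in a chart i of M and a chart j of N. *)
Definition local_mx M N (i : index M) (j : index N) (q : config M N) :
    'M[R]_n :=
  dtrans i (chart_at (src q)) (src q) *m lin q
    *m dtrans (chart_at (tgt q)) j (tgt q).

(* Charts of M and N trivialize the bundle Q over M x N, as a smooth
   subbundle of Hom(TM, TN). *)
Definition abs_continuous_config M N (tau : R) (q : R -> config M N) : Prop :=
  [/\ abs_continuous_curve tau (fun t => src (q t)),
      abs_continuous_curve tau (fun t => tgt (q t)) &
      forall (i : index M) (j : index N) (a b : R), 0 <= a -> b <= tau ->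
        in_chart (fun t => src (q t)) i a b ->
        in_chart (fun t => tgt (q t)) j a b ->
        abs_continuous_on a b (fun t => local_mx i j (q t))].

Definition no_slip M N (tau : R) (q : R -> config M N) : Prop :=
  {ae (@lebesgue_measure R), forall t : R, 0 <= t <= tau ->
    exists2 v : tangent (src (q t)),
      has_velocity (x := fun s => src (q s)) tau v &
      has_velocity (x := fun s => tgt (q s)) tau (act v)}.

Definition no_twist M N (tau : R) (q : R -> config M N) : Prop :=
  forall Z : forall t, tangent (src (q t)),
    abs_continuous_field (x := fun t => src (q t)) tau Z ->
    {ae (@lebesgue_measure R), forall t : R, 0 <= t <= tau ->
      exists2 W : tangent (src (q t)),
        has_covariant_deriv (x := fun s => src (q s)) tau Z W &
        has_covariant_deriv (x := fun s => tgt (q s)) tau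
          (fun s => act (Z s)) (act W)}.

Definition rolling M N (tau : R) (q : R -> config M N) : Prop :=
  [/\ abs_continuous_config tau q, no_slip tau q & no_twist tau q].

End Rolling.

Section Angle.
Context {R : realType}.
Implicit Type M : surface R.

Definition pos_orthonormal_basis M (p : M) (E : 'M[R]_2) : Prop :=
  E *m metric p *m E^T = 1%:M /\ 0 < \det E.

(* In a positively oriented orthonormal basis (e0, e1), the rotation of angle
   theta maps e0 to cos theta e0 + sin theta e1 and e1 to
   - sin theta e0 + cos theta e1. *)
Definition rot_mx (theta : R) : 'M[R]_2 :=
  \matrix_(i < 2, j < 2)
    if i == j then cos theta else if i == 0 then sin theta else - sin theta.

Definition is_rotation M (p : M) (theta : R) (A : 'M[R]_2) : Prop :=
  exists2 E : 'M[R]_2,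
    pos_orthonormal_basis p E & E *m A = rot_mx theta *m E.

(* An element of R/2piZ is represented by the corresponding coset in R: the
   angle from u to w is the set of all theta such that the rotation of angle
   theta takes u to w (a coset as soon as u and w are unit vectors). *)
Definition angle M (p : M) (u w : tangent p) : set R :=
  [set theta | exists2 A : 'M[R]_2,
     is_rotation p theta A & (u : 'rV[R]_2) *m A = w].

End Angle.

(* Main.v *)
Require Import Defs.
From mathcomp Require Import all_boot all_order all_algebra.
From mathcomp Require Import all_classical all_reals all_analysis.
From mathcomp Require Import ring lra.

Import Order.TTheory GRing.Theory Num.Theory.
Import numFieldNormedType.Exports.
Local Open Scope classical_set_scope.
Local Open Scope ring_scope.

(* The no-slip condition dx'/dt = q dx/dt holds almost everywhere, hence
   everywhere by continuity, in particular at both ends.  In dimension 2 an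
   orientation preserving isometry is determined by the image of one unit
   vector.  So, once the base points agree, q(0) = q(tau) iff q(0) and q(tau)
   have the same value on the final velocity of x; as q(0) preserves angles,
   this says that the angles between the initial and final velocities agree. *)

(** * Two by two matrices and the shape of SO(2) *)

Lemma sum_I2 (V : nmodType) (F : 'I_2 -> V) : \sum_i F i = F 0 + F 1.
Proof.
rewrite !big_ord_recl big_ord0 addr0; congr (F _ + F _); exact: val_inj.
Qed.

Lemma matrix2P (T : Type) (A B : 'M[T]_2) :
  A 0 0 = B 0 0 -> A 0 1 = B 0 1 -> A 1 0 = B 1 0 -> A 1 1 = B 1 1 -> A = B.
Proof.
move=> A00 A01 A10 A11; apply/matrixP => i j.
have I2 (k : 'I_2) : k = 0 \/ k = 1.
  by case: k => [[|[|]]] //= ?; [left|right]; exact: val_inj.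
by case: (I2 i) => ->; case: (I2 j) => ->.
Qed.

Lemma det_mx2 {R : comPzRingType} (A : 'M[R]_2) :
  \det A = A 0 0 * A 1 1 - A 0 1 * A 1 0.
Proof.
rewrite (expand_det_row _ 0) sum_I2 /cofactor !det_mx11 !mxE /=.
rewrite expr0 expr1 mul1r mulN1r mulrN.
by congr (_ * A _ _ - _ * A _ _); exact: val_inj.
Qed.

(** By Lagrange's identity the determinant squares to 1, so it is 1. Expanding the second row along
    the first row and its quarter turn then determines it. *)
Lemma special_orthogonal2 {R : realFieldType} {T : 'M[R]_2} :
  T *m T^T = 1%:M -> 0 < \det T -> T 1 1 = T 0 0 /\ T 1 0 = - T 0 1.
Proof.
move=> TT; rewrite det_mx2 => detT.
have TTE i j : T i 0 * T j 0 + T i 1 * T j 1 = (i == j)%:R.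
  have := congr1 (fun A : 'M[R]_2 => A i j) TT.
  by rewrite !mxE sum_I2 !mxE.
have := TTE 0 0; have := TTE 1 1; have := TTE 0 1 => /=.
move: detT; set a := T 0 0; set b := T 0 1; set c := T 1 0; set d := T 1 1.
move=> detT acbd cd ab.
have det1 : a * d - b * c = 1.
  have : (a * d - b * c - 1) * (a * d - b * c + 1) = 0.
    rewrite [LHS](_ : _ = (a * a + b * b) * (c * c + d * d) - 1
      - (a * c + b * d) * (a * c + b * d)); last by ring.
    by rewrite ab cd acbd mulr1 mulr0 subrr subr0.
  by move=> /eqP; rewrite mulf_eq0 => /orP[|] /eqP; lra.
split.
  have : d * (a * a + b * b) =
      a * (a * d - b * c) + b * (a * c + b * d) by ring.
  by rewrite ab det1 acbd; lra.
have : c * (a * a + b * b) = a * (a * c + b * d) - b * (a * d - b * c) by ring.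
by rewrite ab det1 acbd; lra.
Qed.

(** * Positive orthonormal frames, rotations and angles in a tangent plane *)

Section Frames.
Context {R : realType}.
Implicit Types M N : surface R.

Lemma pos_orthonormal_basis_unit {M} {p : M} {E} :
  pos_orthonormal_basis p E -> E \in unitmx.
Proof. by case=> _ detE; rewrite unitmxE unitfE gt_eqF. Qed.

(** [E' *m invmx E] is orthogonal because both Gram matrices are the identity, and its determinant
    is positive because both frames are. *)
Lemma pos_orthonormal_basis_change {M} {p : M} {E E'} :
    pos_orthonormal_basis p E -> pos_orthonormal_basis p E' ->
  exists T : 'M[R]_2,
    [/\ E' = T *m E, T 1 1 = T 0 0, T 1 0 = - T 0 1 &
        T 0 0 ^+ 2 + T 0 1 ^+ 2 = 1].
Proof.
move=> E_on; have Eu := pos_orthonormal_basis_unit E_on.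
case: E_on => EE detE [EE' detE'].
have TE : E' *m invmx E *m E = E' by rewrite mulmxKV.
move: (E' *m _) TE => T TE; rewrite -TE trmx_mul in EE'.
have TT : T *m T^T = 1%:M.
  by rewrite -EE' !mulmxA -2!(mulmxA T) EE mulmx1.
have detT : 0 < \det T by move: detE'; rewrite -TE det_mulmx pmulr_lgt0.
have [T11 T10] := special_orthogonal2 TT detT.
exists T; split => //.
by have := congr1 (fun A : 'M[R]_2 => A 0 0) TT; rewrite !mxE sum_I2 !mxE.
Qed.

(** The two frames differ by an element of SO(2), which commutes with [rot_mx theta]; so the
    rotation does not depend on the frame that defines it. *)
Lemma is_rotation_unique {M} {p : M} {theta A B} :
  is_rotation p theta A -> is_rotation p theta B -> A = B.
Proof.
move=> [E E_on EA] [F F_on FB].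
have Fu := pos_orthonormal_basis_unit F_on.
have [T [FE T11 T10 _]] := pos_orthonormal_basis_change E_on F_on.
apply: (can_inj (mulKmx Fu)); rewrite FB FE -mulmxA EA !mulmxA.
congr (_ *m _); apply: matrix2P; rewrite !mxE !sum_I2 !mxE /= ?T11 ?T10; ring.
Qed.

Lemma metric_sym M (p : M) : (metric p)^T = metric p.
Proof. exact/gram_sym/dom_chart_at. Qed.

(* The second vector of the basis is a multiple of the first one rotated by a
   right angle and lowered by the metric. *)
Lemma pos_orthonormal_basis_extend {M} {p : M} (u : tangent p) :
    inner u u = 1 ->
  exists2 E : 'M[R]_2, pos_orthonormal_basis p E & row 0 E = u.
Proof.
rewrite /inner; set G := metric p => uu.
pose U := (u : 'rV[R]_2) *m G.
pose v : 'rV[R]_2 := \row_j if j == 0 then - U 0 1 else U 0 0.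
have UE (w : 'rV[R]_2) :
    ((u : 'rV[R]_2) *m G *m w^T) 0 0 = U 0 0 * w 0 0 + U 0 1 * w 0 1.
  by rewrite mxE sum_I2 !mxE.
have vE0 : v 0 0 = - U 0 1 by rewrite mxE.
have vE1 : v 0 1 = U 0 0 by rewrite mxE.
have v0 : v != 0.
  apply/eqP => /rowP v0; have := v0 0; have := v0 1.
  rewrite vE0 vE1 ![(0 : 'rV[R]_2) _ _]mxE => U0 /eqP.
  rewrite oppr_eq0 => /eqP U1.
  by move: uu; rewrite UE U0 U1 !mul0r addr0 => /eqP; rewrite eq_sym oner_eq0.
have vv : 0 < (v *m G *m v^T) 0 0 := gram_posdef (dom_chart_at p) v0.
set s := (v *m G *m v^T) 0 0 in vv.
have s0 : 0 < (Num.sqrt s)^-1 by rewrite invr_gt0 sqrtr_gt0.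
pose c := (Num.sqrt s)^-1.
have uv : ((u : 'rV[R]_2) *m G *m v^T) 0 0 = 0.
  by rewrite UE vE0 vE1; ring.
have vu : (v *m G *m (u : 'rV[R]_2)^T) 0 0 = 0.
  rewrite -[RHS]uv -[in RHS](trmxK (_ *m v^T)) [in RHS]mxE.
  by rewrite !trmx_mul trmxK metric_sym mulmxA.
have rowE (A : 'M[R]_2) i j :
    (A *m G *m A^T) i j = (row i A *m G *m (row j A)^T) 0 0.
  by rewrite !mxE; apply: eq_bigr => k _; rewrite !mxE; congr (_ * _);
    apply: eq_bigr => l _; rewrite !mxE.
pose E : 'M[R]_2 :=
  \matrix_(i, j) if i == 0 then (u : 'rV[R]_2) 0 j else c * v 0 j.
have E0 : row 0 E = u by apply/rowP => j; rewrite !mxE.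
have E1 : row 1 E = c *: v by apply/rowP => j; rewrite !mxE.
exists E => //; split.
  apply: matrix2P; rewrite rowE ?E0 ?E1 [in RHS]mxE /=.
  - by rewrite uu.
  - by rewrite linearZ -scalemxAr mxE uv mulr0.
  - by rewrite -!scalemxAl mxE vu mulr0.
  - rewrite linearZ -scalemxAr -!scalemxAl mxE [in X in _ * X]mxE -/s mulrA.
    by rewrite -expr2 exprVn sqr_sqrtr ?mulVf ?gt_eqF ?ltW.
have EE0 j : E 0 j = (u : 'rV[R]_2) 0 j by rewrite mxE.
have EE1 j : E 1 j = c * v 0 j by rewrite mxE.
(* The determinant of the rows [u] and [c v] is [c] times the squared norm of [u], that is [c]. *)
rewrite det_mx2 !EE0 !EE1 vE0 vE1 [ltRHS](_ : _ =
    c * (U 0 0 * (u : 'rV[R]_2) 0 0 + U 0 1 * (u : 'rV[R]_2) 0 1)).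
  by rewrite -UE uu mulr1.
by ring.
Qed.

(** [acos a] has the right cosine and sine [|b|]; the sign of [b] decides between it and its
    opposite. *)
Lemma cos_sin_surj {a b : R} :
  a ^+ 2 + b ^+ 2 = 1 -> exists theta, cos theta = a /\ sin theta = b.
Proof.
move=> ab.
have a1 : -1 <= a <= 1 by apply/andP; split; nra.
have sE : sin (acos a) = `|b|.
  by rewrite sin_acos // -sqrtr_sqr; congr Num.sqrt; rewrite -ab; ring.
have [b0|b0] := leP 0 b.
  by exists (acos a); rewrite acosK // sE ger0_norm.
by exists (- acos a); rewrite cosN sinN acosK // sE ltr0_norm // opprK.
Qed.

(** Complete [u] and [w] to frames. The first row of the transition matrix lies on the unit circle,
    hence is the first row of some [rot_mx theta]. *)
Lemma angle_ex {M} {p : M} {u w : tangent p} :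
  inner u u = 1 -> inner w w = 1 -> exists theta, angle u w theta.
Proof.
move=> /pos_orthonormal_basis_extend[E E_on Eu].
move=> /pos_orthonormal_basis_extend[F F_on Fw].
have Eunit := pos_orthonormal_basis_unit E_on.
have [T [FE _ _ /cos_sin_surj[theta [cosT sinT]]]] :=
  pos_orthonormal_basis_change E_on F_on.
exists theta, (invmx E *m rot_mx theta *m E).
  by exists E => //; rewrite !mulmxA mulmxV // mul1mx.
rewrite -Eu -Fw FE !row_mul !mulmxA; congr (_ *m _).
rewrite -row_mul mulmxV //; apply/rowP => j.
rewrite -row_mul mul1mx !mxE; case: eqP => [<-|/eqP j0]; first by [].
by rewrite eqxx sinT; congr (T _ _); apply/val_inj; case: j j0 => -[|[|]].
Qed.

(** * Orientation preserving isometries between tangent planes *)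

Section SpecialIsometries.
Context {M N : surface R} {p : M} {p' : N} {L : 'M[R]_2}.
Hypothesis L_SO : is_SO p p' L.

Lemma is_SO_unit : L \in unitmx.
Proof. by case: L_SO => _ detL; rewrite unitmxE unitfE gt_eqF. Qed.

Lemma is_SO_inner (u v : tangent p) :
  inner (p := p') ((u : 'rV[R]_2) *m L) ((v : 'rV[R]_2) *m L) = inner u v.
Proof. by case: L_SO. Qed.

Lemma is_SO_metric : L *m metric p' *m L^T = metric p.
Proof.
apply/matrixP => i j; have := is_SO_inner (delta_mx 0 i) (delta_mx 0 j).
rewrite /inner trmx_mul !mulmxA -!mulmxA [_ *m (L^T *m _)]mulmxA.
have deltaE (A : 'M[R]_2) :
    (delta_mx (0 : 'I_1) i *m (A *m (delta_mx (0 : 'I_1) j)^T)) 0 0 = A i j.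
  by rewrite trmx_delta -rowE -colE !mxE.
rewrite [_ *m (metric p' *m _)]mulmxA [_ *m (metric p' *m L^T *m _)]mulmxA.
by rewrite !deltaE mulmxA.
Qed.

Lemma is_SO_basis {E} :
  pos_orthonormal_basis p E -> pos_orthonormal_basis p' (E *m L).
Proof.
move=> [EE detE]; split; last by rewrite det_mulmx mulr_gt0 //; case: L_SO.
by rewrite trmx_mul !mulmxA -EE -is_SO_metric !mulmxA.
Qed.

(** Conjugating a rotation by [L] gives the rotation of the same angle, as seen in the image frame
    [E *m L]. *)
Lemma is_SO_angle_sub (u w : tangent p) :
  angle u w `<=`
  angle (p := p') ((u : 'rV[R]_2) *m L) ((w : 'rV[R]_2) *m L).
Proof.
move=> theta [A [E E_on EA] uA].
have LV := mulKVmx is_SO_unit; exists (invmx L *m A *m L).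
  exists (E *m L); first exact: is_SO_basis.
  by rewrite !mulmxA mulmxK ?is_SO_unit // EA.
by rewrite !mulmxA mulmxK ?is_SO_unit // uA.
Qed.

End SpecialIsometries.

Lemma is_SO_inv {M N} {p : M} {p' : N} {L : 'M[R]_2} :
  is_SO p p' L -> is_SO p' p (invmx L).
Proof.
move=> L_SO; have Lu := is_SO_unit L_SO; split.
  by move=> u v; rewrite -(is_SO_inner L_SO) !mulmxKV.
by rewrite det_inv invr_gt0; case: L_SO.
Qed.

Lemma is_SO_angle {M N} {p : M} {p' : N} {L : 'M[R]_2} (u w : tangent p) :
  is_SO p p' L ->
  angle (p := p') ((u : 'rV[R]_2) *m L) ((w : 'rV[R]_2) *m L) = angle u w.
Proof.
move=> L_SO; apply/seteqP; split; last exact: is_SO_angle_sub.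
move=> theta /(is_SO_angle_sub (is_SO_inv L_SO)).
by rewrite !mulmxK ?(is_SO_unit L_SO).
Qed.

(** Take a frame that starts with [w]. Its images under [A] and [B] share their first vector, so the
    transition matrix has first row (1, 0), and its SO(2) shape forces it to be the identity. *)
Lemma is_SO_eq {M N} {p : M} {p' : N} {A B : 'M[R]_2} {w : tangent p} :
    is_SO p p' A -> is_SO p p' B -> inner w w = 1 ->
  (w : 'rV[R]_2) *m A = (w : 'rV[R]_2) *m B -> A = B.
Proof.
move=> A_SO B_SO /pos_orthonormal_basis_extend[E E_on Ew] wAB.
have EA_on := is_SO_basis A_SO E_on.
have EAu := pos_orthonormal_basis_unit EA_on.
have [T [EB T11 T10 _]] :=
  pos_orthonormal_basis_change EA_on (is_SO_basis B_SO E_on).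
apply: (can_inj (mulKmx (pos_orthonormal_basis_unit E_on))).
have T0 : row 0 T = row 0 1%:M.
  apply: (can_inj (mulmxK EAu)).
  by rewrite -!row_mul -EB mul1mx !row_mul Ew.
have T0E j := congr1 (fun v : 'rV[R]_2 => v 0 j) T0.
rewrite EB [T](_ : _ = 1%:M) ?mul1mx //.
have := T0E 0; have := T0E 1; rewrite !mxE /= => T01 T00.
by apply: matrix2P; rewrite !mxE /= ?T11 ?T10 ?T01 ?T00 ?oppr0.
Qed.

(** The angles are taken at the base points of [c] although [w] is based at [src d]: this typechecks
    because every [tangent] is the same space of row vectors, and it makes sense once the base
    points agree. *)
Lemma config_eq {M N} (c d : config M N) (u : tangent (src c))
    (w : tangent (src d)) :
    inner u u = 1 -> inner w w = 1 ->
  c = d <->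
  [/\ src c = src d, tgt c = tgt d &
      angle (p := src c) u w =
      angle (p := tgt c) ((u : 'rV[R]_2) *m lin c) ((w : 'rV[R]_2) *m lin d)].
Proof.
case: c d u w => [p p' A A_SO] [r r' B B_SO] /= u w uu ww; split.
  move=> [pr pr' AB]; subst r r' B; split => //.
  by rewrite is_SO_angle.
move=> [pr pr']; subst r r'; rewrite -(is_SO_angle u w A_SO) => uw.
(* Angles are sets, so their equality is informative only if they are nonempty. A common [theta]
   gives a single rotation taking the image of [u] to the images of [w] under both [A] and [B]. *)
have [theta] := angle_ex (etrans (is_SO_inner A_SO u u) uu)
  (etrans (is_SO_inner A_SO w w) ww).
move=> uwA; have := uwA; rewrite uw.
case: uwA => C Crot uC [D Drot uD].
have AB : A = B.
  apply: (is_SO_eq A_SO B_SO ww).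
  by rewrite -uC -uD (is_rotation_unique Crot Drot).
by subst B; congr Config; exact: Prop_irrelevance.
Qed.

End Frames.

(** * Analysis on an interval: one-sided derivatives, absolute continuity, null sets *)

Lemma ae_imply {R : realType} {P Q : R -> Prop} :
    (forall t, P t -> Q t) ->
    {ae (@lebesgue_measure R), forall t, P t} ->
  {ae (@lebesgue_measure R), forall t, Q t}.
Proof.
exact: (@filterS _ _ (ae_filter_ringOfSetsType (@lebesgue_measure R))).
Qed.

Lemma cvg_mulmx_coord {R : realType} {T : Type} {F : set_system T}
    {FF : Filter F} {m n p : nat} {A : T -> 'M[R]_(m, n)}
    {B : T -> 'M[R]_(n, p)}
    {A0 : 'M[R]_(m, n)} {B0 : 'M[R]_(n, p)}
    (i : 'I_m) (j : 'I_p) :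
    A @ F --> A0 -> B @ F --> B0 ->
  (fun t => (A t *m B t) i j) @ F --> (A0 *m B0) i j.
Proof.
move=> AA0 BB0; rewrite [(A0 *m B0) i j]mxE.
have -> : (fun t => (A t *m B t) i j) = (fun t => \sum_k A t i k * B t k j).
  by apply/funext => t; rewrite mxE.
apply: (@cvg_big R 'I_n +%R 0 xpredT add_continuous) => k _.
apply: cvgM.
  exact: (continuous_cvg FF (@coord_continuous _ _ _ i k A0) AA0).
exact: (continuous_cvg FF (@coord_continuous _ _ _ k j B0) BB0).
Qed.

Section Derivatives.
Context {R : realType}.

(** Makes limits of difference quotients unique, at the ends of the interval too: points near [t]
    are found on its right if [t < b], on its left otherwise. *)
Lemma dnbhs_itv_proper {a b t : R} :
  a < b -> a <= t <= b -> ProperFilter (within `[a, b] t^').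
Proof.
move=> ab /andP[at_ tb]; apply: Build_ProperFilter_ex => P.
rewrite /within /= /dnbhs /within /= => /nbhs_ballP[e /= e0 eP].
have [tltb|blet] := ltP t b.
  pose s := t + Num.min (e / 2) (b - t).
  have m0 : 0 < Num.min (e / 2) (b - t).
    by rewrite lt_min; apply/andP; split; lra.
  have me : Num.min (e / 2) (b - t) <= e / 2 by rewrite ge_min lexx.
  have mb : Num.min (e / 2) (b - t) <= b - t by rewrite ge_min lexx orbT.
  exists s; apply: eP; rewrite /s.
  - by rewrite /ball /= ltr_norml; apply/andP; split; lra.
  - by rewrite gt_eqF //; lra.
  - by rewrite /= in_itv /=; apply/andP; split; lra.
pose m := Num.min (e / 2) (b - a).
have m0 : 0 < m by rewrite lt_min; apply/andP; split; lra.
have me : m <= e / 2 by rewrite ge_min lexx.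
have mb : m <= b - a by rewrite ge_min lexx orbT.
exists (t - m); apply: eP.
- by rewrite /ball /= ltr_norml; apply/andP; split; lra.
- by rewrite lt_eqF //; lra.
- by rewrite /= in_itv /=; apply/andP; split; lra.
Qed.

Lemma has_deriv_on_unique {V : normedModType R} {a b t : R} {f : R -> V}
    {l m : V} :
    a < b -> a <= t <= b ->
  has_deriv_on `[a, b] f t l -> has_deriv_on `[a, b] f t m -> l = m.
Proof.
move=> ab tab; have FF := dnbhs_itv_proper ab tab.
exact: (cvg_unique (@norm_hausdorff _ _)).
Qed.

Lemma deriv_on_eq {V : normedModType R} {a b t : R} {f : R -> V} {l : V} :
    a < b -> a <= t <= b ->
  has_deriv_on `[a, b] f t l -> deriv_on `[a, b] f t = l.
Proof.
move=> ab tab; have FF := dnbhs_itv_proper ab tab.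
exact: (cvg_lim (@norm_hausdorff _ _)).
Qed.

(** The difference quotient involves the value at [t], which the punctured filter does not see;
    hence the separate hypothesis there. *)
Lemma has_deriv_on_near_eq {V : normedModType R} {A : set R} {f g : R -> V}
    {t : R} {l : V} :
    f t = g t -> (\forall s \near within A t^', f s = g s) ->
  has_deriv_on A f t l -> has_deriv_on A g t l.
Proof.
move=> ft fg; apply: cvg_trans; apply: near_eq_cvg.
by apply: filterS fg => s fgs; rewrite ft fgs.
Qed.

Lemma within_dnbhs_nbhs {A : set R} {t : R} {P : set R} :
  (\forall s \near within A (nbhs t), P s) -> \forall s \near within A t^', P s.
Proof.
by rewrite !near_withinE; exact: cvg_within.
Qed.

Lemma has_deriv_on_cvg {V : normedModType R} {A : set R} {f : R -> V}
    {t : R} {l : V} :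
  has_deriv_on A f t l -> f @ within A (nbhs t) --> f t.
Proof.
move=> ftl; have fcvg : f @ within A t^' --> f t.
  have st : (fun s : R => s - t) @ within A t^' --> (0 : R).
    have st : (fun s : R => s - t) @ nbhs t --> (0 : R).
      by rewrite -(subrr t); apply: cvgB; [exact: cvg_id | exact: cvg_cst].
    by apply: cvg_within_filter; apply: cvg_trans st; apply: cvg_app;
      exact: cvg_within.
  have : (fun s => f t + (s - t) *: ((s - t)^-1 *: (f s - f t)))
      @ within A t^' --> f t.
    rewrite -[f t in X in _ --> X]addr0 -(scale0r l).
    by apply: cvgD; [exact: cvg_cst | exact: cvgZ].
  apply: cvg_trans; apply: near_eq_cvg.
  rewrite near_withinE /dnbhs near_withinE; apply: filterE => s st0 _.
  by rewrite scalerA divff ?scale1r ?subrKC // subr_eq0.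
(* Passing from the punctured filter to the full one only adds the point [t] itself. *)
move=> P Pft; have Pt := nbhs_singleton Pft.
have Pdnbhs : nbhs t (fun s => s != t -> A s -> P (f s)) := fcvg P Pft.
suff: nbhs t (fun s => A s -> P (f s)) by [].
by apply: filterS Pdnbhs => s; have [->|_] := eqVneq s t; [move=> _ _ | exact].
Qed.

(** Chain rule: the quotient of [g \o f] splits into the differential of [g] applied to the quotient
    of [f], and a remainder that tends to 0. *)
Lemma has_deriv_on_comp {V W : normedModType R} {A : set R} {f : R -> V}
    {g : V -> W} {t : R} {l : V} :
    differentiable g (f t) ->
  has_deriv_on A f t l -> has_deriv_on A (g \o f) t ('d g (f t) l).
Proof.
move=> dg ftl.
have dgc : continuous ('d g (f t)) by exact: diff_continuous.
have fc : f @ within A t^' --> f t.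
  by move=> P /(has_deriv_on_cvg ftl); exact: within_dnbhs_nbhs.
have main : (fun s => 'd g (f t) ((s - t)^-1 *: (f s - f t))) @ within A t^' -->
    'd g (f t) l.
  by apply: continuous_cvg => //; exact: dgc.
have rem : (fun s => (s - t)^-1 *: (g (f s) - g (f t) - 'd g (f t) (f s - f t)))
    @ within A t^' --> (0 : W).
  apply/cvgr0Pnorm_le => e e0.
  (* The quotient of [f] is eventually bounded by [|l| + 1], so the little-o estimate is used with
     constant [e / (|l| + 1)]. *)
  have l1 : 0 < `|l| + 1 by rewrite ltr_wpDl.
  have := diff_locally dg.
  move=> /eqaddoP /(_ _ (divr_gt0 e0 l1)); rewrite nearE /= => gnear.
  have fsub : (fun s => f s - f t) @ within A t^' --> (0 : V).
    by rewrite -(subrr (f t)); apply: cvgB => //; exact: cvg_cst.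
  have lb : \forall s \near within A t^',
      `|(s - t)^-1 *: (f s - f t)| <= `|l| + 1.
    by apply: (cvgr_norm_le _ ftl); rewrite ltrDl ltr01.
  apply: filterS2 lb (fsub _ gnear) => s lb /=.
  rewrite /cst /= !fctE /= subrK opprD addrA => gl.
  rewrite normrZ; apply: le_trans (ler_wpM2l (normr_ge0 _) gl) _.
  rewrite mulrCA -normrZ; apply: le_trans (ler_wpM2l _ lb) _.
    by rewrite divr_ge0 // ltW.
  by rewrite divfK ?gt_eqF.
suff : (fun s => (s - t)^-1 *: (g (f s) - g (f t))) @ within A t^' -->
  'd g (f t) l + 0 by rewrite addr0.
apply: cvg_trans (cvgD main rem); apply: near_eq_cvg; apply: filterE => s /=.
by rewrite !fctE linearZ -scalerDr subrKC.
Qed.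

Lemma within_itv_cvg {T : topologicalType} {a b c d t : R} {f : R -> T}
    {l : T} :
    c <= a -> b <= d ->
  f @ within `[c, d] (nbhs t) --> l -> f @ within `[a, b] (nbhs t) --> l.
Proof.
move=> ca bd; apply: cvg_trans; apply: cvg_app; apply: within_subset.
by move=> s; rewrite /= !in_itv /= => /andP[as_ sb];
  rewrite (le_trans ca as_) (le_trans sb bd).
Qed.

Lemma abs_continuous_on_cvg {V : normedModType R} {a b t : R} {f : R -> V} :
    abs_continuous_on a b f -> a <= t <= b ->
  f @ within `[a, b] (nbhs t) --> f t.
Proof.
move=> ac /andP[at_ tb]; apply/cvgrPdist_lt => e /ac[d d0 small].
suff: nbhs t (fun s => `[a, b]%classic s -> `|f t - f s| < e) by [].
apply/nbhs_ballP; exists d => // s; rewrite /ball /= => std.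
rewrite in_itv /= => /andP[as_ sb].
(* Absolute continuity is applied to the single interval between [s] and [t]. *)
have := small 1 (fun=> Num.min s t) (fun=> Num.max s t).
rewrite !big_ord1.
have [st|ts] := ltP s t => small1.
  apply: small1; first by split=> //; exact: ltW.
    by move=> j k; rewrite !ord1 eqxx.
  by move: std; rewrite ger0_norm //; lra.
rewrite distrC; apply: small1; first by split=> //; exact: ltW.
  by move=> j k; rewrite !ord1 eqxx.
by move: std; rewrite ler0_norm; lra.
Qed.

(** Otherwise the exceptional null set would contain an interval of positive length. *)
Lemma ae_itv_ex {P : R -> Prop} {a b : R} :
    {ae (@lebesgue_measure R), forall t, P t} -> a < b ->
  exists2 t, a < t < b & P t.
Proof.
move=> [B [mB B0 PB]] ab; apply: contrapT => noP.
have abB : `]a, b[ `<=` B.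
  move=> t; rewrite /= in_itv /= => tab; apply: PB => /= Pt.
  by apply: noP; exists t.
have : (lebesgue_measure `]a, b[%classic <= lebesgue_measure B)%E.
  by apply: le_measure => //; rewrite inE.
rewrite B0 lebesgue_measure_itv /= lte_fin ab -EFinB lee_fin; lra.
Qed.

Lemma ae_eq_cvg {V : normedModType R} {a b t : R} {f g : R -> V} :
    a < b -> a <= t <= b ->
    f @ within `[a, b] (nbhs t) --> f t ->
    g @ within `[a, b] (nbhs t) --> g t ->
    {ae (@lebesgue_measure R), forall s, a <= s <= b -> f s = g s} ->
  f t = g t.
Proof.
move=> ab /andP[at_ tb] ft gt fg; apply/eqP; rewrite -subr_eq0 -normr_le0.
apply/ler_addgt0Pl => e e0; rewrite addr0.
have : (fun s => f s - g s) @ within `[a, b] (nbhs t) --> f t - g t.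
  exact: cvgB.
move=> /cvgrPdist_lt /(_ _ e0) near_t.
have {near_t} : nbhs t (fun s => `[a, b]%classic s ->
  `|f t - g t - (f s - g s)| < e) := near_t.
move=> /nbhs_ballP[d /= d0 dP].
(* The part of []a, b[] within [d] of [t] is a nonempty open interval, even when [t] is an end, so
   it contains a point where [f] and [g] agree. *)
pose c1 := Num.max a (t - d); pose c2 := Num.min b (t + d).
have c12 : c1 < c2 by rewrite lt_min !gt_max; repeat (apply/andP; split); lra.
have [s /andP[c1s sc2] fgs] := ae_itv_ex fg c12.
move: c1s sc2; rewrite gt_max lt_min => /andP[as_ tds] /andP[sb std].
have sab : a <= s <= b by rewrite !ltW.
have := dP s; rewrite (fgs sab) subrr subr0 => /(_ _ _)/ltW; apply.
  by rewrite /ball /= ltr_norml; apply/andP; split; lra.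
by rewrite /= in_itv.
Qed.

End Derivatives.

(** * Velocities in charts and the no-slip equation at every time *)

Section Charts.
Context {R : realType} {n : nat}.
Implicit Types M N : riemannian R n.

Lemma continuous_within_cvg {M} {tau t : R} {x : R -> M} :
    {within `[0, tau], continuous x} -> 0 <= t <= tau ->
  x @ within `[0, tau] (nbhs t) --> x t.
Proof. by move=> /subspace_continuousP + tP; apply; rewrite /= in_itv. Qed.

Lemma near_in_chart {M} {tau t : R} {x : R -> M} {i : Defs.index M} :
    {within `[0, tau], continuous x} -> 0 <= t <= tau -> dom i (x t) ->
  \forall s \near within `[0, tau] (nbhs t), dom i (x s).
Proof.
move=> xc tP xi; apply: (continuous_within_cvg xc tP).
by apply: open_nbhs_nbhs; split; [exact: dom_open | ].
Qed.

Lemma transition_differentiable {M} {i j : Defs.index M} {p : M} :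
  dom i p -> dom j p -> differentiable (phi j \o psi i) (phi i p).
Proof.
by move=> ip jp; case: (transition_smooth i j 1) => + _; apply; exists p.
Qed.

(** Chain rule for the transition map. Precomposed with [phi i \o x] it gives [phi j \o x] only
    while [x] stays in [dom i], which continuity ensures near [t]. *)
Lemma has_deriv_on_change_chart {M} {tau t : R} {x : R -> M}
    {i j : Defs.index M} {l : 'rV[R]_n} :
    {within `[0, tau], continuous x} -> 0 <= t <= tau ->
    dom i (x t) -> dom j (x t) ->
  has_deriv_on `[0, tau] (phi i \o x) t l ->
  has_deriv_on `[0, tau] (phi j \o x) t (l *m dtrans i j (x t)).
Proof.
move=> xc tP xi xj /(has_deriv_on_comp (transition_differentiable xi xj)).
rewrite -mul_rV_lin1; apply: has_deriv_on_near_eq; first by rewrite /= phiK.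
apply: within_dnbhs_nbhs; apply: filterS (near_in_chart xc tP xi) => s xsi.
by rewrite /= phiK.
Qed.

(** [phi i \o psi i] is known to be the identity only on the image of the chart; as this image is
    open, the derivatives are those of the identity. *)
Lemma dtrans_id {M} {i : Defs.index M} {p : M} : dom i p -> dtrans i i p = 1%:M.
Proof.
move=> ip; apply/row_matrixP => k; rewrite !rowE mul_rV_lin1 mulmx1.
rewrite -deriveE; last exact: transition_differentiable.
rewrite -[RHS](@derive_id R _ (phi i p)); apply: near_eq_derive.
have : nbhs (phi i p) (phi i @` dom i).
  by apply: open_nbhs_nbhs; split; [exact: img_open | exists p].
by apply: filterS => _ [r ir <-] /=; rewrite phiK.
Qed.

(* In fixed charts around x(t) and x'(t), both sides of the no-slip equation
   are continuous functions of time near t, and they agree almost everywhere. *)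
Lemma rolling_velocity {M N} {tau : R} {q : R -> config M N} {t : R} :
    let x s := src (q s) in let x' s := tgt (q s) in
    0 < tau -> rolling tau q -> C2_curve tau x -> C2_curve tau x' ->
    0 <= t <= tau ->
  velocity tau x' t = (velocity tau x t : 'rV[R]_n) *m lin (q t).
Proof.
move=> x x' tau0 [[_ _ acq] slip _] [xc xC2] [x'c x'C2] tP.
pose i := chart_at (x t); pose j := chart_at (x' t).
have xi : dom i (x t) by exact: dom_chart_at.
have xj : dom j (x' t) by exact: dom_chart_at.
have [f [f2 fP]] := xC2 i; have [g [g2 gP]] := x'C2 j.
have [ft ft' _] := fP t tP xi; have [gt gt' _] := gP t tP xj.
have -> : velocity tau x t = f t := deriv_on_eq tau0 tP ft.
have -> : velocity tau x' t = g t := deriv_on_eq tau0 tP gt.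
have : nbhs t (fun s => `[0, tau]%classic s -> dom i (x s) /\ dom j (x' s)).
  apply: filterS2 (near_in_chart xc tP xi) (near_in_chart x'c tP xj).
  by [].
move=> /nbhs_ballP[e /= e0 eP]; have /andP[t0 tt] := tP.
(* Halving [e] keeps the closed interval [[a, b]] inside the ball, so both curves stay in their
   charts on all of it. *)
pose a := Num.max 0 (t - e / 2); pose b := Num.min tau (t + e / 2).
have a0 : 0 <= a by rewrite le_max lexx.
have btau : b <= tau by rewrite ge_min lexx.
have ab : a < b by rewrite lt_min !gt_max; repeat (apply/andP; split); lra.
have tab : a <= t <= b.
  by rewrite le_min ge_max; repeat (apply/andP; split); lra.
have domab s : a <= s <= b -> [/\ 0 <= s <= tau, dom i (x s) & dom j (x' s)].
  rewrite le_min ge_max => /andP[/andP[s0 ts] /andP[stau st]].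
  have sP : 0 <= s <= tau by rewrite s0.
  have [//||//] := eP s; last by rewrite /= in_itv.
  by rewrite /ball /= ltr_norml; apply/andP; split; lra.
have lc : (fun s => local_mx i j (q s)) @ within `[a, b] (nbhs t) -->
    local_mx i j (q t).
  by apply: abs_continuous_on_cvg tab; apply: acq => // s /domab[].
have fgae : {ae (@lebesgue_measure R), forall s, a <= s <= b ->
    g s = f s *m local_mx i j (q s)}.
  apply: ae_imply slip => s slip /domab[sP xsi xsj].
  have [v vs v's] := slip sP.
  have [fs _ _] := fP s sP xsi; have [gs _ _] := gP s sP xsj.
  have cs := dom_chart_at (x s); have c's := dom_chart_at (x' s).
  (* The no-slip condition at [s] is written in the charts selected at [x s] and [x' s], which vary
     with [s]; it is transported to the fixed charts [i] and [j]. *)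
  have gE := has_deriv_on_change_chart x'c sP c's xsj v's.
  rewrite (has_deriv_on_unique tau0 sP gs gE).
  have vE := has_deriv_on_change_chart xc sP xsi cs fs.
  rewrite (has_deriv_on_unique tau0 sP vs vE).
  by rewrite /local_mx !mulmxA.
have fgt : g t = f t *m local_mx i j (q t).
  apply/rowP => k; apply: (ae_eq_cvg ab tab
    (f := fun s => g s 0 k) (g := fun s => (f s *m local_mx i j (q s)) 0 k)).
  - have gc := within_itv_cvg a0 btau (has_deriv_on_cvg gt').
    exact: (continuous_cvg _ (@coord_continuous _ _ _ 0 k (g t)) gc).
  - apply: cvg_mulmx_coord lc.
    exact: within_itv_cvg a0 btau (has_deriv_on_cvg ft').
  - by apply: ae_imply fgae => s fgs sab; rewrite fgs.
(* At time [t] itself [i] and [j] are the selected charts, so the local matrix of [q t] is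
   [lin (q t)]. *)
by rewrite fgt /local_mx !dtrans_id // mul1mx mulmx1.
Qed.

End Charts.

Theorem corollary1 (R : realType) (M N : surface R) (tau : R) (tau_gt0 : 0 < tau)
    (q : R -> config M N) (q_rolling : rolling tau q) :
  let x : R -> M := fun t => src (q t) in
  let x' : R -> N := fun t => tgt (q t) in
  C2_curve tau x -> C2_curve tau x' ->
  arclength tau x -> arclength tau x' ->
  q 0 = q tau <->
  [/\ x 0 = x tau, x' 0 = x' tau &
      angle (p := x 0) (velocity tau x 0) (velocity tau x tau) =
      angle (p := x' 0) (velocity tau x' 0) (velocity tau x' tau)].
Proof.
move=> x x' xC2 x'C2 x_unit _.
have t0 : 0 <= (0 : R) <= tau by rewrite lexx ltW.
have t1 : 0 <= tau <= tau by rewrite lexx ltW.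
(* Once both velocities of [x'] are images of those of [x], the claim is [config_eq] for [q 0] and
   [q tau]. *)
rewrite (rolling_velocity tau_gt0 q_rolling xC2 x'C2 t0).
rewrite (rolling_velocity tau_gt0 q_rolling xC2 x'C2 t1).
exact: config_eq (x_unit _ t0) (x_unit _ t1).
Qed.
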